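(* Let $V$ be a vector space over a field $k$ and let $\varphi,\psi\in\mathrm{End}_k(V)$ be two finite potent endomorphisms. Then $\varphi\leq^{1GD}\psi$ if and only if both of the following hold: (I) $\mathrm{Im}(\psi-\varphi)\subseteq U_\varphi$; (II) $\varphi\leq^{-}\psi$.
   Context: $k$ is an arbitrary field, $V$ an arbitrary (possibly infinite-dimensional) $k$-vector space. An endomorphism $\varphi\in\mathrm{End}_k(V)$ is finite potent if $\varphi^n(V)$ is finite dimensional for some $n\ge 1$. For such $\varphi$ there is a unique $\varphi$-invariant decomposition $V=W_\varphi\oplus U_\varphi$ (the AST decomposition) with $W_\varphi$ finite dimensional, $\varphi|_{W_\varphi}$ an automorphism of $W_\varphi$, and $\varphi|_{U_\varphi}$ nilpotent; the index $m=i(\varphi)$ is the nilpotency order of $\varphi|_{U_\varphi}$ ($i(\varphi)=0$ iff $V$ is finite dimensional and $\varphi$ is an automorphism). A $\{1\}$-inverse of $\varphi$ is $\varphi^-\in\mathrm{End}_k(V)$ with $\varphi\varphi^-\varphi=\varphi$; the set of them is $X_\varphi(1)$, and $X_\varphi^{fp}(1)$ is the subset of those that are finite potent. A G-Drazin inverse of $\varphi$ is $\varphi^{GD}\in\mathrm{End}_k(V)$ with $\varphi\varphi^{GD}\varphi=\varphi$ and $\varphi^{GD}\varphi^m=\varphi^m\varphi^{GD}$; the set of them is $X_\varphi(GD)$. $X_\varphi(1GD)$ is the set of 1GD inverses of $\varphi$: those $\chi\in\mathrm{End}_k(V)$ such that $\chi\varphi\chi=\chi$, $\chi\varphi=\varphi^-\varphi$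 and $\varphi\chi=\varphi\varphi^{GD}$ for some $\varphi^-\in X_\varphi(1)$, $\varphi^{GD}\in X_\varphi(GD)$. For finite potent $\varphi,\psi$: $\varphi\leq^{1GD}\psi$ means that there are $\hat\varphi^{1GD},\tilde\varphi^{1GD}\in X_\varphi(1GD)$ with $\varphi\hat\varphi^{1GD}=\psi\hat\varphi^{1GD}$ and $\tilde\varphi^{1GD}\varphi=\tilde\varphi^{1GD}\psi$. The minus partial order $\varphi\leq^-\psi$ means $X_\psi^{fp}(1)\subseteq X_\varphi^{fp}(1)$. *)

(* Defs.v *)
From HB Require Import structures.
From mathcomp Require Import all_boot all_order all_algebra.
From mathcomp Require Import boolp classical_sets functions.
Set Implicit Arguments.
Unset Strict Implicit.
Unset Printing Implicit Defensive.
Import GRing.Theory.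
Local Open Scope classical_set_scope.
Local Open Scope ring_scope.

Section FinitePotent.
Variables (k : fieldType) (V : lmodType k).
Implicit Types (phi psi chi : {linear V -> V}) (W U : set V) (m n : nat).

Definition subspace W : Prop := submod_closed [in W].

(* W is the linear span of a finite family; in particular W is a subspace. *)
Definition finite_dim W : Prop :=
  exists n (b : 'I_n -> V),
    W = range (fun c : 'I_n -> k => \sum_(i < n) c i *: b i).

Definition finite_potent phi : Prop :=
  exists2 n, (0 < n)%N & finite_dim (range (iter n phi)).

(* f^n vanishes on U *)
Definition iter_zero_on phi U n : Prop := forall u, U u -> iter n phi u = 0.

Record is_AST phi W U : Prop := {
  AST_subspaceW : subspace W;
  AST_subspaceU : subspace U;
  AST_sum : forall v, exists w u, [/\ W w, U u & v = w + u];
  AST_direct : W `&` U = [set 0];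
  AST_finite : finite_dim W;
  AST_auto : set_bij W W phi;
  AST_stableU : set_fun U U phi;
  AST_nilpotent : exists n, iter_zero_on phi U n
}.

(* The summand U_phi of the AST decomposition of phi. That decomposition
   exists and is unique when phi is finite potent, so that AST_U phi is then
   the summand U of any W, U with is_AST phi W U. *)
Definition AST_U phi : set V := [set v | exists W U, is_AST phi W U /\ U v].

(* m = i(phi); m = 0 when AST_U phi is the zero subspace. *)
Definition is_index phi m : Prop :=
  iter_zero_on phi (AST_U phi) m /\
  forall n, iter_zero_on phi (AST_U phi) n -> (m <= n)%N.

Definition X1 phi : set {linear V -> V} :=
  [set g : {linear V -> V} | phi \o g \o phi =1 phi].

Definition X1fp phi : set {linear V -> V} :=
  [set g | X1 phi g /\ finite_potent g].

Definition XGD phi : set {linear V -> V} :=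
  [set g : {linear V -> V} | phi \o g \o phi =1 phi /\
     exists2 m, is_index phi m & g \o iter m phi =1 iter m phi \o g].

Definition X1GD phi : set {linear V -> V} :=
  [set chi : {linear V -> V} | chi \o phi \o chi =1 chi /\
     exists g h : {linear V -> V}, [/\ X1 phi g, XGD phi h,
       chi \o phi =1 g \o phi & phi \o chi =1 phi \o h]].

Definition le_1GD phi psi : Prop :=
  (exists2 chi : {linear V -> V}, X1GD phi chi & phi \o chi =1 psi \o chi) /\
  (exists2 chi : {linear V -> V}, X1GD phi chi & chi \o phi =1 chi \o psi).

Definition le_minus phi psi : Prop := X1fp psi `<=` X1fp phi.

End FinitePotent.

(* Main.v *)
(** For a reflexive inverse chi of phi, being a 1GD inverse amounts to
    phi chi preserving U_phi.  If phi c = psi c and d phi = d psi for such c, d,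
    then phi = psi c phi = phi d psi, so every {1}-inverse of psi is one of phi;
    moreover phi d vanishes on Im (psi - phi) and its kernel lies in U_phi.

    Conversely, psi has a finite potent {1}-inverse g: on a finite-dimensional
    image of psi^N any {1}-inverse will do, and it is prolonged along the images
    of lower powers of psi as one builds Jordan chains.  Perturbing g by rank
    one maps, the minus order gives phi = phi g phi = phi g psi = psi g phi.
    The inverse of phi on W_phi plus the compression of g to U_phi is a G-Drazin
    inverse h with phi h psi = phi, and g phi h and h phi h are the required
    1GD inverses. *)
From HB Require Import structures.
Require Import Defs.
From mathcomp Require Import all_boot all_order all_algebra.
From mathcomp Require Import boolp classical_sets functions.
Import GRing.Theory.
Local Open Scope classical_set_scope.
Local Open Scope ring_scope.

(** * Linear relations and selection of linear maps *)

Definition linear_relation {k : fieldType} {U V : lmodType k}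
    (R : U -> V -> Prop) : Prop :=
  R 0 0 /\ forall a x x' y y', R x x' -> R y y' -> R (a *: x + y) (a *: x' + y').

Lemma linear_of_fun {k : fieldType} {U V : lmodType k} (f : U -> V) :
  linear f -> exists g : {linear U -> V}, g =1 f.
Proof.
move=> lf; pose m := GRing.isLinear.Build k U V *:%R f lf.
by exists (HB.pack_for {linear U -> V} f m).
Qed.

(* The single source of projectors, sections and extensions of linear maps in
   infinite dimension: Zorn's lemma on the functional relations between G and R. *)
Lemma linear_selection {k : fieldType} {U V : lmodType k}
    (G R : U -> V -> Prop) :
  linear_relation G -> linear_relation R ->
  (forall y, G 0 y -> y = 0) -> (forall x y, G x y -> R x y) ->
  (forall x, exists y, R x y) ->
  exists f : {linear U -> V}, (forall x y, G x y -> f x = y) /\ forall x, R x (f x).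
Proof.
move=> linG linR G0 GR totR.
(* Zorn is applied to the pairs added to [G]: the union of the empty chain is empty, and [up] turns
   it into [G], which is good. *)
pose up (X : set (U * V)) x y := G x y \/ X (x, y).
pose good (X : set (U * V)) :=
  [/\ linear_relation (up X), forall y, up X 0 y -> y = 0
    & forall x y, up X x y -> R x y].
have [F Fgood totF|H [[linH H0 HR] Hmax]] := @Zorn_bigcup _ good.
  have upF x y : up (\bigcup_(X in F) X) x y -> G x y \/ exists2 X, F X & up X x y.
    by case=> [|[X FX Xxy]]; [left|right; exists X => //; right].
  have upU X x y : F X -> up X x y -> up (\bigcup_(X in F) X) x y.
    by move=> FX [|Xxy]; [left|right; exists X].
  split.
  - split=> [|a x x' y y' /upF Hx /upF Hy]; first by left; case: linG.
    have [] : (G x x' /\ G y y') \/ exists2 X, F X & up X x x' /\ up X y y'.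
    + case: Hx Hy => [Gx|[X FX Xx]] [Gy|[Y FY Yy]]; first by left.
      * by right; exists Y => //; split=> //; left.
      * by right; exists X => //; split=> //; left.
      * right; have [XY|YX] := totF _ _ FX FY.
          by exists Y => //; split=> //; case: Xx => [|/XY]; [left|right].
        by exists X => //; split=> //; case: Yy => [|/YX]; [left|right].
    + by case=> Gx Gy; left; apply: linG.2.
    + case=> X FX [Xx Xy]; apply: (upU _ _ _ FX).
      by have [[_ +] _ _] := Fgood _ FX; apply.
  - by move=> y /upF[/G0//|[X /Fgood[_ + _]]]; apply.
  - by move=> x y /upF[/GR//|[X /Fgood[_ _ +]]]; apply.
have totH x : exists y, up H x y.
  apply: contrapT => nHx; have [w Rxw] := totR x.
  (* Adjoin to [up H] the line through [(x, w)], where [w] is an admissible value at [x]. *)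
  pose H' : set (U * V) := [set p | exists a x' y', up H x' y' /\
     p = (a *: x + x', a *: w + y')].
  have HH' u y : up H u y -> H' (u, y).
    by move=> Huy; exists 0, u, y; rewrite !scale0r !add0r.
  have upH' u y : up H' u y -> H' (u, y).
    by case=> // Guy; apply: HH'; left.
  apply: (Hmax H').
    split=> [[u y] Huy|H'H]; first by apply: HH'; right.
    apply: nHx; exists w; right; apply: H'H; exists 1, 0, 0.
    by rewrite !scale1r !addr0; split=> //; case: linH.
  split.
  - split=> [|c u u' y y' /upH'[a [x1 [y1 [H1 [-> ->]]]]]
      /upH'[b [x2 [y2 [H2 [-> ->]]]]]]; first by left; case: linG.
    right; exists (c * a + b), (c *: x1 + x2), (c *: y1 + y2).
    split; first exact: linH.2.
    by congr pair; rewrite scalerDr scalerA scalerDl addrACA.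
  - move=> y /upH'[a [x1 [y1 [H1 [/esym e ->]]]]].
    (* If [a] is nonzero, [x] is a multiple of [x1] and thus already in the domain of [up H]. *)
    have [a0|aN0] := eqVneq a 0.
      move: e H1; rewrite a0 !scale0r !add0r => ->; exact: H0.
    case: nHx; exists (- a^-1 *: y1 + 0).
    have -> : x = - a^-1 *: x1 + 0.
      move/eqP: e; rewrite addrC addr_eq0 => /eqP ->.
      by rewrite addr0 scaleNr scalerN opprK scalerA mulVf ?scale1r.
    by apply: linH.2 => //; case: linH.
  - move=> u y /upH'[a [x1 [y1 [H1 [-> ->]]]]].
    by apply: linR.2 => //; apply: HR.
have [f Hf] := choice totH.
have funH x y y' : up H x y -> up H x y' -> y = y'.
  move=> h h'; apply/eqP; rewrite -subr_eq0; apply/eqP/H0.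
  by have := linH.2 (-1) _ _ _ _ h' h; rewrite !scaleN1r addNr addrC.
have lf : linear f.
  by move=> a x y; apply: (funH (a *: x + y)) => //; apply: linH.2.
have [g gf] := linear_of_fun _ lf.
exists g; split=> [x y Gxy|x]; rewrite gf; last exact: HR.
by apply: (funH x) => //; left.
Qed.

(** * Subspaces, iterates and finite dimension *)

Lemma subspaceP {k : fieldType} {V : lmodType k} (W : set V) :
  subspace W <-> W 0 /\ forall a u v, W u -> W v -> W (a *: u + v).
Proof.
split=> -[W0 WD]; split.
- by move: W0; rewrite in_setE.
- move=> a u v Wu Wv; have := WD a u v.
  by rewrite !in_setE; apply.
- by rewrite in_setE.
- by move=> a u v; rewrite !in_setE; apply: WD.
Qed.

Section Subspaces.
Context {k : fieldType} {V : lmodType k}.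
Implicit Types (f g : {linear V -> V}) (W : set V).

Lemma subspaceD W u v : subspace W -> W u -> W v -> W (u + v).
Proof. by move=> /subspaceP[_ WD] Wu Wv; rewrite -[u]scale1r; apply: WD. Qed.

Lemma subspaceB W u v : subspace W -> W u -> W v -> W (u - v).
Proof.
by move=> /subspaceP[_ WD] Wu Wv; rewrite addrC -scaleN1r; apply: WD.
Qed.

Lemma subspace_image f W : subspace W -> subspace (f @` W).
Proof.
move=> /subspaceP[W0 WD]; apply/subspaceP; split; first by exists 0; rewrite ?linear0.
by move=> a _ _ [u Wu <-] [v Wv <-]; exists (a *: u + v); rewrite ?linearP//; apply: WD.
Qed.

Lemma subspaceT : subspace [set: V].
Proof. exact/subspaceP. Qed.

Lemma subspace_projector W : subspace W ->
  exists p : {linear V -> V}, (forall w, W w -> p w = w) /\ forall v, W (p v).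
Proof.
move=> /subspaceP[W0 WD].
have [||||x|p [pW Wp]] := @linear_selection k V V
  (fun x y => W x /\ x = y) (fun _ y => W y).
- by split=> // a x x' y y' [Wx <-] [Wy <-]; split=> //; apply: WD.
- by split=> // *; apply: WD.
- by move=> y [].
- by move=> x y [Wx <-].
- by exists 0.
- by exists p; split=> // w Ww; apply: pW.
Qed.

Lemma iter_linear f n : exists g : {linear V -> V}, g =1 iter n f.
Proof.
elim: n => [|n [g gE]]; first by exists idfun.
by exists (f \o g) => v /=; rewrite gE.
Qed.

Lemma iter_lin0 f n : iter n f 0 = 0.
Proof. by have [g <-] := iter_linear f n; rewrite linear0. Qed.

Lemma iter_linD f n u v : iter n f (u + v) = iter n f u + iter n f v.
Proof. by have [g gE] := iter_linear f n; rewrite -!gE linearD. Qed.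

Lemma iter_linB f n u v : iter n f (u - v) = iter n f u - iter n f v.
Proof. by have [g gE] := iter_linear f n; rewrite -!gE linearB. Qed.

Lemma subspace_range_iter f n : subspace (range (iter n f)).
Proof.
have [g gE] := iter_linear f n.
rewrite (_ : iter n f = g); last by apply/funext.
exact/subspace_image/subspaceT.
Qed.

Definition lspan {n} (b : 'I_n -> V) : set V :=
  range (fun c : 'I_n -> k => \sum_(i < n) c i *: b i).

Lemma subspace_lspan {n} (b : 'I_n -> V) : subspace (lspan b).
Proof.
apply/subspaceP; split.
  by exists (fun=> 0) => //; rewrite big1// => i _; rewrite scale0r.
move=> a _ _ [c _ <-] [d _ <-]; exists (fun i => a * c i + d i) => //.
rewrite scaler_sumr -big_split /=; apply: eq_bigr => i _.
by rewrite scalerDl scalerA.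
Qed.

Lemma image_lspan f {n} (b : 'I_n -> V) : f @` lspan b = lspan (f \o b).
Proof.
have E (c : 'I_n -> k) : f (\sum_(i < n) c i *: b i) = \sum_(i < n) c i *: f (b i).
  by rewrite linear_sum; apply: eq_bigr => i _; rewrite linearZ.
apply/seteqP; split=> [_ [_ [c _ <-] <-]|_ [c _ <-]].
  by exists c; rewrite ?E.
by exists (\sum_(i < n) c i *: b i); rewrite ?E//; exists c.
Qed.

Lemma lspan_gen {n} (b : 'I_n -> V) i : lspan b (b i).
Proof.
exists (fun j => (j == i)%:R) => //.
rewrite (bigD1 i)//= eqxx scale1r big1 ?addr0// => j /negPf ->.
by rewrite scale0r.
Qed.

Lemma finite_dim_image f W : finite_dim W -> finite_dim (f @` W).
Proof. by move=> [n [b ->]]; exists n, (f \o b); apply: image_lspan. Qed.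

Lemma subspace_finite_dim W : finite_dim W -> subspace W.
Proof. by move=> [n [b ->]]; apply: subspace_lspan. Qed.

(** A projector onto [W] maps [W'] onto [W], so the images of the generators of [W'] span [W]. *)
Lemma finite_dim_sub W W' : subspace W -> finite_dim W' -> W `<=` W' -> finite_dim W.
Proof.
move=> sW fW' WW'; have [p [pW Wp]] := subspace_projector _ sW.
rewrite (_ : W = p @` W'); first exact: finite_dim_image.
by apply/seteqP; split=> [w Ww|_ [w _ <-]//]; exists w; [apply: WW'|apply: pW].
Qed.

Lemma finite_dim_add W W' : finite_dim W -> finite_dim W' ->
  finite_dim [set v | exists w w', [/\ W w, W' w' & v = w + w']].
Proof.
move=> [m [b ->]] [n [b' ->]].
exists (m + n)%N, (fun i : 'I_(m + n) =>
  match fintype.split i with inl i => b i | inr i => b' i end).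
have E (c : 'I_(m + n) -> k) : \sum_(i < m + n) c i *:
    match fintype.split i with inl i => b i | inr i => b' i end =
    \sum_(i < m) c (lshift n i) *: b i + \sum_(i < n) c (rshift m i) *: b' i.
  rewrite big_split_ord /=; congr (_ + _); apply: eq_bigr => i _.
    by rewrite (unsplitK (inl i)).
  by rewrite (unsplitK (inr i)).
apply/seteqP; split=> [_ [_ [_ [[c _ <-] [d _ <-] ->]]]|_ [c _ <-]].
- exists (fun i : 'I_(m + n) => match fintype.split i with inl i => c i | inr i => d i end) => //.
  rewrite E; congr (_ + _); apply: eq_bigr => i _.
    by rewrite (unsplitK (inl i)).
  by rewrite (unsplitK (inr i)).
- rewrite E; do 2 eexists; split; last by [].
    by exists (fun i => c (lshift n i)).
  by exists (fun i => c (rshift m i)).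
Qed.

Lemma lspan_dependent n (b : 'I_n.+1 -> V) (c : 'I_n.+1 -> k) j :
  \sum_(i < n.+1) c i *: b i = 0 -> c j != 0 ->
  lspan b = lspan (b \o lift j).
Proof.
move=> c0 cj; apply/seteqP; split=> [_ [d _ <-]|_ [d _ <-]].
  (* Subtracting [d j / c j] times the relation cancels the coefficient at [j]. *)
  exists (fun i => d (lift j i) - d j / c j * c (lift j i)) => //.
  have e0 : \sum_(i < n.+1) (d j / c j) *: (c i *: b i) = 0.
    by rewrite -scaler_sumr c0 scaler0.
  rewrite -[RHS]subr0 -[X in _ = _ - X]e0 -sumrB.
  rewrite [RHS](bigD1_ord j)//= scalerA divfK// subrr add0r.
  by apply: eq_bigr => i _; rewrite scalerBl scalerA.
exists (fun i => if unlift j i is Some i' then d i' else 0) => //.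
rewrite (bigD1_ord j)//= unlift_none scale0r add0r.
by apply: eq_bigr => i _; rewrite liftK.
Qed.

Lemma range_iterS f n : range (iter n.+1 f) = f @` range (iter n f).
Proof.
apply/seteqP; split=> [_ [v _ <-]|_ [_ [v _ <-] <-]]; last by exists v.
by exists (iter n f v) => //; exists v.
Qed.

(* Choosing the exponent so that the image has the least number of generators
   makes the images of these generators independent, so the map is injective. *)
Lemma finite_potent_stable_range f : finite_potent f ->
  exists N, [/\ finite_dim (range (iter N f)),
    forall w, range (iter N f) w -> f w = 0 -> w = 0
  & forall w, range (iter N f) w -> exists2 w', range (iter N f) w' & f w' = w].
Proof.
case=> n0 _ [d0 [b0 E0]].
have exP : exists d, `[< exists N (b : 'I_d -> V), range (iter N f) = lspan b >].
  by exists d0; apply/asboolP; exists n0, b0.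
case: (ex_minnP exP) => d /asboolP[N [b E]] dmin.
have free (c : 'I_d -> k) : \sum_(i < d) c i *: f (b i) = 0 -> forall i, c i = 0.
  move=> c0 j; apply: contrapT => /eqP cj.
  case: d b E dmin c c0 j cj => [|d] b E dmin c c0 j cj; first by case: j cj.
  have := dmin d; rewrite ltnn => H; suff: false by []; apply/H/asboolP.
  exists N.+1, ((f \o b) \o lift j).
  by rewrite range_iterS E image_lspan (lspan_dependent _ (f \o b) c j c0 cj).
exists N; rewrite E; split; first by exists d, b.
  move=> _ [c _ <-]; rewrite linear_sum => c0.
  rewrite big1// => i _; rewrite (free c) ?scale0r// -[RHS]c0.
  by apply: eq_bigr => l _; rewrite linearZ.
have /choice[a aE] i : exists a : 'I_d -> k, \sum_(j < d) a j *: b j = f (b i).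
  have : lspan b (f (b i)).
    have [v _ vE] : range (iter N f) (b i) by rewrite E; apply: lspan_gen.
    by rewrite -E -vE -iterS iterSr; exists (f v).
  by case=> a _ <-; exists a.
(* The matrix of [f] on the span of [b], acting on rows of coefficients. Independence of the
   [f (b i)] makes it invertible, whence surjectivity. *)
pose A := \matrix_(i, j) a i j.
have fA (c : 'rV_d) : f (\sum_(i < d) c 0 i *: b i) = \sum_(j < d) (c *m A) 0 j *: b j.
  rewrite linear_sum; under eq_bigr do rewrite linearZ /= -aE scaler_sumr.
  rewrite exchange_big; apply: eq_bigr => j _; rewrite mxE scaler_suml.
  by apply: eq_bigr => i _; rewrite mxE scalerA.
have Au : A \in unitmx.
  rewrite -row_free_unit; apply: inj_row_free => c cA0.
  apply/rowP => i; rewrite [RHS]mxE; apply: (free (c 0)).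
  transitivity (f (\sum_(i < d) c 0 i *: b i)).
    by rewrite linear_sum; apply: eq_bigr => l _; rewrite linearZ.
  by rewrite fA cA0 big1// => l _; rewrite mxE scale0r.
move=> _ [c _ <-].
exists (\sum_(i < d) (\row_i c i *m invmx A) 0 i *: b i).
  by exists ((\row_i c i *m invmx A) 0).
by rewrite fA mulmxKV//; apply: eq_bigr => i _; rewrite mxE.
Qed.

(** * Finite-rank perturbations *)

(** The n-th iterates of [g + F] and [g] differ by values in a finite-dimensional space, built
    recursively: [E] is replaced by [g(E) + D]. *)
Lemma finite_potent_perturb (g F : {linear V -> V}) (D : set V) :
  finite_potent g -> finite_dim D -> (forall v, D (F v)) -> finite_potent (g \+ F).
Proof.
move=> [n n0 fg] fD DF; exists n => //.
have [E fE HE] : exists2 E, finite_dim E &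
    forall v, E (iter n (g \+ F) v - iter n g v).
  clear n0 fg; elim: n => [|n [E fE HE]].
    exists (lspan (fun i : 'I_0 => 0)); first by exists 0%N, (fun=> 0).
    by move=> v; rewrite subrr; exists (fun=> 0); rewrite ?big_ord0.
  exists [set v | exists w w', [/\ (g @` E) w, D w' & v = w + w']].
    by apply: finite_dim_add => //; apply: finite_dim_image.
  move=> v; exists (g (iter n (g \+ F) v - iter n g v)), (F (iter n (g \+ F) v)).
  split; [by exists (iter n (g \+ F) v - iter n g v)|exact: DF|].
  by rewrite !iterS linearB addrAC.
apply: (finite_dim_sub _ _ _ (finite_dim_add _ _ fg fE)).
  exact: subspace_range_iter.
move=> _ [v _ <-]; exists (iter n g v), (iter n (g \+ F) v - iter n g v).
split; [by exists v|exact: HE|by rewrite addrC subrK].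
Qed.

(** The map from the line of [x] to the line of [y], well defined as [x] is nonzero, is prolonged
    with values in the line of [y]. *)
Lemma rank_one_map (x y : V) : x != 0 ->
  exists A : {linear V -> V}, A x = y /\ forall v, exists a, A v = a *: y.
Proof.
move=> x0; have [||||v|A [Ax Ay]] := @linear_selection k V V
  (fun u v => exists a, u = a *: x /\ v = a *: y) (fun _ v => exists a, v = a *: y).
- split=> [|c _ _ _ _ [a [-> ->]] [b [-> ->]]]; first by exists 0; rewrite !scale0r.
  by exists (c * a + b); rewrite !scalerDl !scalerA.
- split=> [|c _ _ _ _ [a ->] [b ->]]; first by exists 0; rewrite scale0r.
  by exists (c * a + b); rewrite scalerDl scalerA.
- move=> _ [a [/esym/eqP + ->]].
  by rewrite scaler_eq0 (negPf x0) orbF => /eqP ->; rewrite scale0r.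
- by move=> u v [a [_ ->]]; exists a.
- by exists 0, 0; rewrite scale0r.
- by exists A; split=> //; apply: Ax; exists 1; rewrite !scale1r.
Qed.

Lemma finite_dim_line (y : V) : exists2 D, finite_dim D & forall a, D (a *: y).
Proof.
exists (lspan (fun i : 'I_1 => y)); first by exists 1%N, (fun=> y).
by move=> a; exists (fun=> a); rewrite ?big_ord1.
Qed.

(** * Finite potent {1}-inverses *)

Lemma subspace_section f J : subspace J -> exists p s : {linear V -> V},
  [/\ forall y, (f @` J) y -> p y = y, forall v, (f @` J) (p v),
      forall v, J (s v) & forall v, f (s v) = p v].
Proof.
move=> sJ; have [p [pI Ip]] := subspace_projector _ (subspace_image f _ sJ).
have [J0 JD] := (subspaceP _).1 sJ.
have [||||v|s [_ Js]] := @linear_selection k V V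
  (fun x y => x = 0 /\ y = 0) (fun x y => J y /\ f y = p x).
- by split=> // a x x' y y' [-> ->] [-> ->]; rewrite scaler0 addr0.
- split=> [|a x x' y y' [Jx fx] [Jy fy]]; first by rewrite !linear0.
  by rewrite !linearP fx fy; split=> //; apply: JD.
- by move=> y [].
- by move=> x y [-> ->]; rewrite !linear0.
- by have [w Jw wE] := Ip v; exists w.
- by exists p, s; split=> // v; have [] := Js v.
Qed.

(* Data on J from which a {1}-inverse of f with finite potent restriction to J
   can be extended: q splits off a complement of f(J) killed by g. *)
Definition partial_inverse f J : Prop := exists g q : {linear V -> V},
  [/\ (forall v, (f @` J) (q v)) /\ (forall y, (f @` J) y -> q y = y),
      forall v, g (q v) = g v, forall v, J (g v),
      forall y, (f @` J) y -> f (g y) = y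
    & exists n, finite_dim (iter n g @` J)].

Lemma partial_inverse_finite_dim f J : finite_dim J -> partial_inverse f J.
Proof.
move=> fJ; have [p [s [pI Ip Js fs]]] := subspace_section f _ (subspace_finite_dim _ fJ).
exists (s \o p), p; split=> //=; first by move=> v; rewrite (pI (p v)).
  by move=> y Iy; rewrite fs !pI.
(* Exponent 0 suffices: the image is [J] itself. *)
by exists 0%N; rewrite /= image_id.
Qed.

(* The complement of f(J) in J is chosen to contain a lift s0(C') of the
   complement C' of f(f(J)) in f(J), so that g s0(C') = 0: the heads of the
   Jordan chains of f(J) are prolonged by one step. *)
Lemma partial_inverse_step f J : subspace J -> f @` J `<=` J ->
  partial_inverse f (f @` J) -> partial_inverse f J.
Proof.
move=> sJ IJ [g' [q' [[Iq' q'I] g'q' Ig' fg' [n fin]]]].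
have [p [s0 [pI Ip Js0 fs0]]] := subspace_section f _ sJ.
have sI := subspace_image f _ sJ.
have q'J v : (f @` J) (q' v) by have [y /IJ Jy <-] := Iq' v; exists y.
have q'q' v : q' (q' v) = q' v by apply/q'I/Iq'.
(* [q'] splits f(J) into f(f(J)) and a complement C'. The section [s] lifts the first part by [g']
   and C' by [s0]. *)
have [s sE] : exists s : {linear V -> V},
    forall v, s v = s0 (p v - q' (p v)) + g' (p v).
  by exists (s0 \o (p \- (q' \o p)) \+ (g' \o p)).
(* The correction makes [q] vanish on s0(C'). On f(J) it is zero, since [q'] fixes f(f(J)), so [q]
   is still the identity there. *)
have [q qE] : exists q : {linear V -> V},
    forall v, q v = p (v - s0 (f v - q' (f v))).
  by exists (p \o (idfun \- (s0 \o (f \- (q' \o f))))).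
have fs v : f (s v) = p v.
  rewrite sE linearD fs0 pI; last exact: subspaceB.
  by rewrite -g'q' fg'// subrK.
have qI y : (f @` J) y -> q y = y.
  move=> Iy; have Ify : (f @` (f @` J)) (f y) by exists y.
  by rewrite qE (q'I _ Ify) subrr linear0 subr0 pI.
have Iq v : (f @` J) (q v) by rewrite qE.
have Js v : J (s v) by rewrite sE; apply: subspaceD => //; apply: IJ.
exists (s \o q), q; split=> //=.
- by move=> v; rewrite (qI (q v)).
- by move=> y Iy; rewrite fs qI ?pI.
have g_heads z : (f @` J) z -> s (q (s0 (z - q' z))) = 0.
  move=> Iz; rewrite qE fs0 (pI (z - q' z)); last exact: subspaceB.
  by rewrite (linearB q') q'q' subrr subr0 subrr !linear0.
have g_y y : (f @` J) y -> s (q y) = s0 (y - q' y) + g' y.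
  by move=> Iy; rewrite qI// sE !pI.
(* Each [s0] term is killed at the next application, so only iterates of [g'] survive, followed by
   one last [s \o q]. *)
have iterE m y : (f @` J) y -> iter m.+1 (s \o q) y = s (q (iter m g' y)).
  elim: m y => // m IHm y Iy.
  rewrite iterSr [(s \o q) y]/= g_y// iter_linD (IHm (g' y))// [X in X + _]iterSr.
  by rewrite /= g_heads// iter_lin0 add0r -iterS iterSr.
exists n.+1; apply: (finite_dim_sub _ _ _ (finite_dim_image (s \o q) _ fin)).
  have [h hE] := iter_linear (s \o q) n.+1.
  rewrite -(_ : h = iter n.+1 (s \o q) :> (V -> V)); last exact/funext.
  exact: subspace_image.
move=> _ [v Jv <-]; exists (iter n g' (q v)); first by exists (q v).
by rewrite /= -[LHS]iterE// iterSr /= qI// -iterSr.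
Qed.

(** Start at the finite-dimensional image of [iter N f] and go up, one power at a time, to the image
    of [iter 0 f], the whole space. *)
Lemma X1fp_nonempty f : finite_potent f -> exists g, X1fp f g.
Proof.
move=> [N _ fin]; have : partial_inverse f (range (iter 0 f)).
  have : partial_inverse f (range (iter N f)) by exact: partial_inverse_finite_dim.
  elim: N {fin} => // N IHN pN; apply: IHN; apply: partial_inverse_step.
  - exact: subspace_range_iter.
  - by move=> _ [_ [v _ <-] <-]; exists (f v); rewrite // -iterSr.
  - by rewrite -range_iterS.
rewrite /= image_id => -[g [q [_ _ _ fg [n fin_g]]]]; exists g; split.
  by move=> v /=; rewrite fg//; exists v.
by exists n.+1; rewrite // range_iterS; apply: finite_dim_image.
Qed.

(** * Consequences of the minus order *)

(** If F has rank at most one and hFh = 0, then g + F is again a finite potent {1}-inverse of [h],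
    hence one of [f], so fFf = 0. A failure of either identity yields an F violating this. *)
Lemma le_minus_inner_inverse f h : finite_potent h -> le_minus f h ->
  exists g : {linear V -> V}, [/\ forall v, f (g (f v)) = f v,
    forall v, f (g (h v)) = f v & forall v, h (g (f v)) = f v].
Proof.
move=> /X1fp_nonempty[g [hgh fpg]] fh.
have hghE v : h (g (h v)) = h v := hgh v.
have inner (F : {linear V -> V}) y : (forall v, exists a, F v = a *: y) ->
    (forall v, h (F (h v)) = 0) -> forall v, f (g (f v)) + f (F (f v)) = f v.
  move=> Fy hFh v; have [D fD yD] := finite_dim_line y.
  have [|e _] := fh (g \+ F); last by have := e v; rewrite /= linearD.
  split; last by apply: (finite_potent_perturb _ _ _ fpg fD) => u; have [a ->] := Fy u.
  by move=> u /=; rewrite linearD hFh addr0 hghE.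
have fgf v : f (g (f v)) = f v by have [+ _] := fh g (conj hgh fpg); apply.
have inner0 (F : {linear V -> V}) y : (forall v, exists a, F v = a *: y) ->
    (forall v, h (F (h v)) = 0) -> forall v, f (F (f v)) = 0.
  move=> Fy hFh v.
  by apply: (@addrI _ (f v)); rewrite addr0 -[X in X + _]fgf (inner F y Fy hFh v).
exists g; split=> // v; apply/eqP.
- rewrite eq_sym -subr_eq0 -linearB; set z := v - _; apply/negPn/negP => fz0.
  (* With A(f z) = z and F = (1 - gh)A, one has hF = 0, and h z = 0 gives fFf z = f z, which is
     nonzero. *)
  have [A [Az Azl]] := rank_one_map _ z fz0.
  suff : f ((A \- (g \o (h \o A))) (f z)) = 0.
    rewrite /= Az linearB; have -> : f (g (h z)) = 0.
      by rewrite /z !linearB /= hghE subrr.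
    by rewrite subr0 => fz; rewrite fz eqxx in fz0.
  apply: (inner0 _ (z - g (h z))) => u /=.
    by have [a ->] := Azl u; exists a; rewrite [RHS]scalerBr (linearZZ h) (linearZZ g).
  by rewrite linearB /= hghE subrr.
- rewrite eq_sym -subr_eq0; apply/negPn/negP => z0.
  (* With A(f v - hgf v) = v and F = A(1 - hg), one has Fh = 0 and fFf v = f v, so f v = 0,
     contradicting the choice of v. *)
  have [A [Az Azl]] := rank_one_map _ v z0.
  suff : f ((A \o (idfun \- (h \o g))) (f v)) = 0.
    by rewrite /= Az => fv; rewrite fv (linear0 g) (linear0 h) subr0 eqxx in z0.
  apply: (inner0 _ v) => u /=; first exact: Azl.
  by rewrite hghE subrr !linear0.
Qed.

(** * The AST decomposition *)

Lemma is_AST_range f N :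
  (forall w, range (iter N f) w -> f w = 0 -> w = 0) ->
  (forall w, range (iter N f) w -> exists2 w', range (iter N f) w' & f w' = w) ->
  finite_dim (range (iter N f)) ->
  is_AST f (range (iter N f)) [set v | iter N f v = 0].
Proof.
set W := range _ => inj0 surj fin.
have fW w : W w -> W (f w) by move=> [v _ <-]; exists (f v); rewrite // -iterSr.
have iter_inj n w : W w -> iter n f w = 0 -> w = 0.
  elim: n w => // n IHn w Ww; rewrite iterSr => /(IHn _ (fW _ Ww)); exact: inj0.
have iter_surj n w : W w -> exists2 w', W w' & iter n f w' = w.
  elim: n w => [|n IHn] w Ww; first by exists w.
  by have [w1 /IHn[w2 Ww2 <-] <-] := surj _ Ww; exists w2.
have sW : subspace W := subspace_range_iter _ _.
split=> //.
- apply/subspaceP; split=> /= [|a u v u0 v0]; first exact: iter_lin0.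
  by have [h hE] := iter_linear f N; rewrite -hE linearP !hE u0 v0 scaler0 addr0.
- move=> v; have Wv : W (iter N f v) by exists v.
  (* The W-component of [v] is the [w] in [W] with the same image under [iter N f]. *)
  have [w Ww wv] := iter_surj N _ Wv; exists w, (v - w); split=> //=.
    by rewrite iter_linB wv subrr.
  by rewrite addrC subrK.
- apply/seteqP; split=> [v [Wv /=]|_ ->]; first exact: iter_inj.
  by split; [exists 0; rewrite ?iter_lin0|exact: iter_lin0].
- split=> // u v.
  rewrite !in_setE => Wu Wv fuv; apply/eqP; rewrite -subr_eq0; apply/eqP/inj0.
    exact: subspaceB.
  by rewrite linearB fuv subrr.
- by move=> u /= u0; rewrite -iterSr iterS u0 linear0.
- by exists N.
Qed.

Lemma AST_exists f : finite_potent f -> exists W U, is_AST f W U.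
Proof.
move=> /finite_potent_stable_range[N [fin inj0 surj]].
by exists (range (iter N f)), [set v | iter N f v = 0]; apply: is_AST_range.
Qed.

Lemma AST_ker f W U w : is_AST f W U -> W w -> f w = 0 -> w = 0.
Proof.
move=> [sW _ _ _ _ [_ inj _] _ _] Ww fw; have [W0 _] := (subspaceP _).1 sW.
by apply: inj; rewrite ?in_setE// linear0.
Qed.

Lemma AST_disjoint f W U v : is_AST f W U -> W v -> U v -> v = 0.
Proof. by move=> [_ _ _ WU _ _ _ _] Wv Uv; have : [set 0] v by rewrite -WU. Qed.

(** This description of [U] mentions [f] alone, which gives uniqueness of [U]. If [iter n f] kills w
    + u, the image of w lies in both summands, hence is 0, and [f] is injective on [W]. *)
Lemma AST_U_iter f W U v : is_AST f W U -> U v <-> exists n, iter n f v = 0.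
Proof.
move=> ast; have [sW sU sum _ _ [fW _ _] fU [N UN]] := ast.
split=> [Uv|[n]]; first by exists N; apply: UN.
have [w [u [Ww Uu ->]]] := sum v; rewrite iter_linD => e.
suff -> : w = 0 by rewrite add0r.
have Un : U (iter n f u) by elim: n {e} => //= n IHn; apply: fU.
have Wn m : W (iter m f w) by elim: m => //= m IHm; apply: fW.
have : iter n f w = 0.
  apply: (AST_disjoint _ _ _ _ ast) => //.
  move/eqP: e; rewrite addr_eq0 => /eqP ->.
  by rewrite -sub0r; apply: subspaceB => //; have [] := (subspaceP _).1 sU.
elim: n {e Un} => //= n IHn /(AST_ker _ _ _ _ ast (Wn n)); exact: IHn.
Qed.

Lemma AST_UE f W U : is_AST f W U -> AST_U f = U.
Proof.
move=> ast; apply/seteqP; split=> [v [W' [U' [ast' U'v]]]|v Uv]; last by exists W, U.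
by apply/(AST_U_iter _ _ _ _ ast)/(AST_U_iter _ _ _ _ ast').
Qed.

Lemma is_index_exists f : finite_potent f -> exists m, is_index f m.
Proof.
move=> /AST_exists[W [U ast]].
have exN : exists n, `[< iter_zero_on f (AST_U f) n >].
  have [N UN] := AST_nilpotent ast; exists N; apply/asboolP.
  by rewrite (AST_UE _ _ _ ast).
case: (ex_minnP exN) => m /asboolP fm mmin; exists m; split=> // n fn.
exact/mmin/asboolP.
Qed.

(** The constraint already determines [y]; the selection supplies linearity. *)
Lemma AST_projector f W U : is_AST f W U ->
  exists p : {linear V -> V}, [/\ forall v, W (p v), forall v, U (v - p v),
    forall w, W w -> p w = w & forall u, U u -> p u = 0].
Proof.
move=> ast; have [sW sU sum _ _ _ _ _] := ast.
have [[W0 WD] [U0 UD]] := ((subspaceP _).1 sW, (subspaceP _).1 sU).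
have [||||v|p [_ pWU]] := @linear_selection k V V
  (fun x y => x = 0 /\ y = 0) (fun x y => W y /\ U (x - y)).
- by split=> // a x x' y y' [-> ->] [-> ->]; rewrite scaler0 addr0.
- split=> [|a x x' y y' [Wx Ux] [Wy Uy]]; first by rewrite subrr.
  split; first exact: WD.
  by rewrite opprD addrACA -scalerBr; apply: UD.
- by move=> y [].
- by move=> x y [-> ->]; rewrite subrr.
- by have [w [u [Ww Uu ->]]] := sum v; exists w; rewrite addrC addKr.
have [Wp Up] : (forall v, W (p v)) /\ forall v, U (v - p v).
  by split=> v; have [] := pWU v.
exists p; split=> // [w Ww|u Uu].
  apply/esym/eqP; rewrite -subr_eq0; apply/eqP/(AST_disjoint _ _ _ _ ast) => //.
  exact: subspaceB.
apply: (AST_disjoint _ _ _ _ ast) => //.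
by rewrite -[p u]opprK -[- p u](addKr u) opprD opprK; apply: subspaceB.
Qed.

(** * G-Drazin and 1GD inverses *)

(* h is the inverse of f on W and the compression of g to U. *)
Lemma XGD_of_inner_inverse f g : finite_potent f ->
  (forall v, f (g (f v)) = f v) ->
  exists2 h, XGD f h &
    forall u, AST_U f u -> AST_U f (f (g u)) -> f (h u) = f (g u).
Proof.
move=> ff fgf; have [m im] := is_index_exists _ ff.
have [W [U ast]] := AST_exists _ ff; have UE := AST_UE _ _ _ ast.
have [mU _] := im; rewrite UE in mU *.
have [sW sU sum _ _ [fW _ Wf] fU _] := ast.
have [p [Wp Up pW pU]] := AST_projector _ _ _ ast.
have [W0 WD] := (subspaceP _).1 sW.
have [||||v|D [_ DW]] := @linear_selection k V V
  (fun x y => x = 0 /\ y = 0) (fun x y => W y /\ f y = p x).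
- by split=> // a x x' y y' [-> ->] [-> ->]; rewrite scaler0 addr0.
- split=> [|a x x' y y' [Wx fx] [Wy fy]]; first by rewrite !linear0.
  by rewrite !linearP fx fy; split=> //; apply: WD.
- by move=> y [].
- by move=> x y [-> ->]; rewrite !linear0.
- by have [w Ww wE] := Wf _ (Wp v); exists w.
have WDv v : W (D v) by have [] := DW v.
have fD v : f (D v) = p v by have [] := DW v.
have [h hE] : exists h : {linear V -> V},
    forall v, h v = D v + (g (v - p v) - p (g (v - p v))).
  by exists (D \+ ((idfun \- p) \o (g \o (idfun \- p)))).
have hW w : W w -> h w = D w by move=> Ww; rewrite hE pW// subrr !linear0 !addr0.
have hU u : U u -> h u = g u - p (g u).
  move=> Uu; rewrite hE pU// subr0 (AST_ker _ _ _ (D u) ast) ?add0r//.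
  by rewrite fD pU.
have fUU u : U u -> U (f u) by exact: fU.
have fWW w : W w -> W (f w) by exact: fW.
have fhU u : U u -> U (f (g u)) -> f (h u) = f (g u).
  move=> Uu Ufgu; rewrite hU// linearB.
  rewrite (AST_disjoint _ _ _ (f (p (g u))) ast) ?subr0//; first exact/fW/Wp.
  (* This vector of [W] is also a difference of two vectors of [U], hence zero. *)
  have -> : f (p (g u)) = f (g u) - f (g u - p (g u)).
    by rewrite -linearB opprB addrC subrK.
  by apply: subspaceB => //; apply: fUU.
exists h => //; split=> [v /=|].
  have [w [u [/fWW Ww /fUU Uu ->]]] := sum v.
  by rewrite !linearD /= [f (h (f u))]fhU ?fgf// hW// fD pW.
exists m => // v /=; have [w [u [Ww Uu ->]]] := sum v.
(* The [U] parts vanish on both sides, as [h] preserves [U]; on [W], [h] inverts [f] and so commutes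
   with it. *)
rewrite iter_linD !linearD iter_linD (mU u)// linear0 (mU (h u)); last by rewrite hU.
rewrite !addr0; elim: m {im mU} w Ww => // m IHm w Ww; rewrite !iterSr IHm; last exact: fW.
congr (iter m f _); rewrite !hW//; last exact: fW.
rewrite fD pW//; apply/eqP; rewrite -subr_eq0; apply/eqP/(AST_ker _ _ _ _ ast).
  exact: subspaceB.
by rewrite linearB fD pW ?subrr//; apply: fW.
Qed.

Lemma X1GD_reflexive f chi : X1GD f chi ->
  (forall v, chi (f (chi v)) = chi v) /\ forall v, f (chi (f v)) = f v.
Proof.
move=> [cfc [g [h [fgf _ cf _]]]]; split=> v; first exact: cfc.
have cfE : chi (f v) = g (f v) := cf v.
by rewrite cfE; apply: fgf.
Qed.

(** [f chi = f h] for a G-Drazin inverse [h]; commutation with [iter m f], which kills [U], puts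
    [h u] in [U]. *)
Lemma X1GD_stable f chi u : finite_potent f -> X1GD f chi ->
  AST_U f u -> AST_U f (f (chi u)).
Proof.
move=> ff [_ [g [h [_ [_ [m [fm _] comm]] _ fc]]]] Uu.
have [W [U ast]] := AST_exists _ ff.
have -> : f (chi u) = f (h u) := fc u.
rewrite (AST_UE _ _ _ ast); apply: (AST_stableU ast).
apply/(AST_U_iter _ _ _ _ ast); exists m.
by rewrite -[LHS](comm u) /= fm ?linear0.
Qed.

Lemma X1GD_intro f g h : X1 f g -> XGD f h -> X1GD f (g \o (f \o h)).
Proof.
move=> fgf fh; have [fhf _] := fh.
have fgfE v : f (g (f v)) = f v := fgf v.
have fhfE v : f (h (f v)) = f v := fhf v.
split=> [v /=|]; first by rewrite fgfE fhfE.
by exists g, h; split=> // v /=; rewrite ?fhfE ?fgfE.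
Qed.

(** * From the 1GD order to its two consequences *)

(** [f chi] kills w + u in the image of h - f, fixes [W] and preserves [U]. Hence w = - f chi u lies
    in both summands. *)
Lemma le_1GD_range f h : finite_potent f -> le_1GD f h ->
  range (fun v => h v - f v) `<=` AST_U f.
Proof.
move=> ff [_ [chi fchi cfh]] _ [v _ <-].
have [W [U ast]] := AST_exists _ ff; have UE := AST_UE _ _ _ ast.
have := @X1GD_stable f chi; rewrite UE => stab.
have [sW sU sum _ _ [fW _ Wf] _ _] := ast.
have [w [u [Ww Uu e]]] := sum (h v - f v); rewrite e.
suff -> : w = 0 by rewrite add0r.
have [_ fcf] := X1GD_reflexive _ _ fchi.
have fcw : f (chi w) = w by have [w' _ <-] := Wf _ Ww; rewrite fcf.
have cfhE : chi (f v) = chi (h v) := cfh v.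
have : f (chi (w + u)) = 0 by rewrite -e !linearB /= -cfhE subrr.
rewrite !linearD /= fcw => /eqP; rewrite addr_eq0 => /eqP wE.
apply: (AST_disjoint _ _ _ _ ast) => //; rewrite wE -sub0r.
by apply: subspaceB => //; [have [] := (subspaceP _).1 sU|apply: stab].
Qed.

Lemma le_1GD_le_minus f h : le_1GD f h -> le_minus f h.
Proof.
move=> [[c fc fch] [d fd dfh]] g [hgh fpg]; split=> // v /=.
have hghE u : h (g (h u)) = h u := hgh u.
have fchE u : f (c u) = h (c u) := fch u.
have dfhE u : d (f u) = d (h u) := dfh u.
have [_ fcf] := X1GD_reflexive _ _ fc; have [_ fdf] := X1GD_reflexive _ _ fd.
have fl u : f u = f (d (h u)) by rewrite -dfhE fdf.
have fr u : f u = h (c (f u)) by rewrite -fchE fcf.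
(* That is, fgf = fdhghcf = fdhcf = fcf = f. *)
by rewrite (fr v) fl hghE -fl fcf -fr.
Qed.

End Subspaces.

Theorem theorem4p30 (k : fieldType) (V : lmodType k) (phi psi : {linear V -> V})
    (hphi : finite_potent phi) (hpsi : finite_potent psi) :
  le_1GD phi psi <->
  range (fun v => psi v - phi v) `<=` AST_U phi /\ le_minus phi psi.
Proof.
split=> [le|[sub le]]; first by split; [exact: le_1GD_range|exact: le_1GD_le_minus].
have [g [fgf fgh hgf]] := le_minus_inner_inverse _ _ hpsi le.
have [h fh hU] := XGD_of_inner_inverse _ _ hphi fgf.
have [fhf _] := fh; have fhfE v : phi (h (phi v)) = phi v := fhf v.
(* [phi g] kills psi v - phi v, which lies in U_phi by (I); there [phi h] agrees with [phi g]. *)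
have fhpsi v : phi (h (psi v)) = phi v.
  have g0 : phi (g (psi v - phi v)) = 0 by rewrite !linearB /= fgh fgf subrr.
  apply/eqP; rewrite -subr_eq0 -[X in _ - X]fhfE -!linearB /= hU ?g0//.
    by apply: sub; exists v.
  have [W [U ast]] := AST_exists _ hphi.
  by rewrite (AST_UE _ _ _ ast); apply/(AST_U_iter _ _ _ _ ast); exists 0%N.
split.
  by exists (g \o (phi \o h)); [exact: X1GD_intro|move=> v /=; rewrite hgf fgf].
(* Here [h] serves both as the {1}-inverse and as the G-Drazin inverse. *)
by exists (h \o (phi \o h)); [exact: X1GD_intro|move=> v /=; rewrite fhpsi fhfE].
Qed.
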